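(* Let $n \ge 1$ and let $\Phi, \Psi : [0,\infty) \to [0,\infty)$ be Young functions. Then the following statements are equivalent: (1) There exists a constant $C>0$ such that $\Phi(t) \leq \Psi(Ct)$ for every $t > 0$. (2) $L_{\Psi}(\mathbb{R}^n) \subseteq L_{\Phi}(\mathbb{R}^n)$. (3) There exists a constant $C>0$ such that $\| f \|_{L_\Phi(\mathbb{R}^n)} \leq C \| f \|_{L_\Psi(\mathbb{R}^n)}$ for every $f \in L_{\Psi}(\mathbb{R}^n)$.
   Context: A Young function is a function $\Phi:[0,\infty)\to[0,\infty)$ that is convex, left-continuous, with $\Phi(0)=0$ and $\lim_{t\to\infty}\Phi(t)=\infty$. $\mathbb{R}^n$ carries Lebesgue measure. The Orlicz space $L_\Phi(\mathbb{R}^n)$ is the set of measurable functions $f:\mathbb{R}^n\to\mathbb{R}$ such that $\int_{\mathbb{R}^n}\Phi(a|f(x)|)\,dx<\infty$ for some $a>0$, with norm $$\|f\|_{L_\Phi(\mathbb{R}^n)} := \inf\left\{b>0 : \int_{\mathbb{R}^n}\Phi\left(\frac{|f(x)|}{b}\right)dx\le 1\right\}.$$ Functions equal almost everywhere are identified. *)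

(* Defs.v *)
From HB Require Import structures.
From mathcomp Require Import all_boot all_order all_algebra.
From mathcomp Require Import all_classical all_reals all_analysis.

Set Implicit Arguments.
Unset Strict Implicit.
Unset Printing Implicit Defensive.

Import Order.TTheory GRing.Theory Num.Theory.
Import numFieldNormedType.Exports.

Local Open Scope classical_set_scope.
Local Open Scope ring_scope.

(* A Young function [0, oo) -> [0, oo) is represented by a function on R of
   which only the restriction to [0, oo) is constrained or ever used. *)
Record young_function (R : realType) (Phi : R -> R) : Prop := {
  young_ge0 : forall t, 0 <= t -> 0 <= Phi t;
  young_convex : convex_function (`[0, +oo[%classic : set R) Phi;
  young_left_continuous : forall t, 0 < t -> Phi s @[s --> t^'-] --> Phi t;
  young0 : Phi 0 = 0;
  young_pinfty : Phi t @[t --> +oo] --> +oo }.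

Section orlicz.
Context d (T : measurableType d) (R : realType).
Variables (mu : {measure set T -> \bar R}) (Phi : R -> R).

Definition orlicz_space : set (T -> R) :=
  [set f : T -> R | measurable_fun [set: T] f /\
    exists2 a : R, 0 < a & (\int[mu]_x (Phi (a * `|f x|))%:E < +oo)%E].

(* The infimum is taken in \bar R, so that the norm of a function outside the
   space is +oo; an infimum in R would give it the value inf set0 = 0. *)
Definition orlicz_norm (f : T -> R) : \bar R :=
  ereal_inf [set b%:E | b in [set b : R |
    0 < b /\ (\int[mu]_x (Phi (`|f x| / b))%:E <= 1)%E]].

End orlicz.

Section borel_lebesgue.
Local Open Scope ereal_scope.
Variable R : realType.
Local Notation BR := (measurableTypeR R).

(* Lebesgue measure on the Borel sets of R^n, as the n-fold product of
   lebesgue_measure: at each step the product measure on R * R^n is transported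
   to R^n.+1 along cons_pair. *)
Definition cons_pair n (p : BR * n.-tuple BR) : n.+1.-tuple BR :=
  [tuple of p.1 :: p.2].

Lemma measurable_cons_pair n :
  measurable_fun [set: BR * n.-tuple BR] (@cons_pair n).
Proof. exact: measurable_cons. Qed.

Section step.
Variables (n : nat) (m : {sigma_finite_measure set (n.-tuple BR) -> \bar R}).

Definition lebesgue_cons : set (n.+1.-tuple BR) -> \bar R :=
  pushforward (@lebesgue_measure R \x m) (@cons_pair n).

Let mpre (A : set (n.+1.-tuple BR)) :
  measurable A -> measurable (@cons_pair n @^-1` A).
Proof.
by move=> mA; rewrite -[X in measurable X]setTI; exact: measurable_cons_pair.
Qed.

Let lebesgue_cons0 : lebesgue_cons set0 = 0.
Proof. by rewrite /lebesgue_cons /pushforward preimage_set0 measure0. Qed.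

Let lebesgue_cons_ge0 A : 0 <= lebesgue_cons A.
Proof. by rewrite /lebesgue_cons /pushforward measure_ge0. Qed.

Let lebesgue_cons_sigma_additive : semi_sigma_additive lebesgue_cons.
Proof.
move=> F mF tF mUF; rewrite /lebesgue_cons /pushforward preimage_bigcup.
apply: measure_semi_sigma_additive; first by move=> i; exact: mpre.
  apply/trivIsetP => i j _ _ ij; rewrite -preimage_setI.
  by move/trivIsetP : tF => /(_ _ _ _ _ ij) ->//; rewrite preimage_set0.
by rewrite -preimage_bigcup; exact: mpre.
Qed.

HB.instance Definition _ := isMeasure.Build _ _ _ lebesgue_cons
  lebesgue_cons0 lebesgue_cons_ge0 lebesgue_cons_sigma_additive.

Lemma lebesgue_consE (A : set BR) (B : set (n.-tuple BR)) :
  measurable A -> measurable B ->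
  lebesgue_cons [set x | A (thead x) /\ B [tuple of behead x]] =
  lebesgue_measure A * m B.
Proof.
move=> mA mB; rewrite -product_measure1E//; congr product_measure1.
have E (x : BR) (t : n.-tuple BR) : [tuple of behead (cons_pair (x, t))] = t.
  exact: val_inj.
by apply/seteqP; split=> -[x t] /=; rewrite theadE E.
Qed.

Let lebesgue_cons_sigma_finite :
  sigma_finite [set: n.+1.-tuple BR] lebesgue_cons.
Proof.
have /sigma_finiteP[F [TF ndF Foo]] := sigma_finiteT (@lebesgue_measure R).
have /sigma_finiteP[G [TG ndG Goo]] := sigma_finiteT m.
pose H k : set (n.+1.-tuple BR) :=
  [set x | F k (thead x) /\ G k [tuple of behead x]].
exists H.
  apply/esym; rewrite -subTset => x _.
  have [i _ Fi] : (\bigcup_i F i) (thead x) by rewrite -TF.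
  have [j _ Gj] : (\bigcup_i G i) [tuple of behead x] by rewrite -TG.
  exists (maxn i j) => //; split.
    by have /subsetPset := ndF _ _ (leq_maxl i j); exact.
  by have /subsetPset := ndG _ _ (leq_maxr i j); exact.
move=> k; have [mF Fk] := Foo k; have [mG Gk] := Goo k; split.
  apply: measurableI.
    by rewrite -[X in measurable X]setTI; exact: measurable_tnth.
  by rewrite -[X in measurable X]setTI; exact: measurable_behead.
by rewrite lebesgue_consE// lte_mul_pinfty// ge0_fin_numE.
Qed.

HB.instance Definition _ := Measure_isSigmaFinite.Build _ _ _ lebesgue_cons
  lebesgue_cons_sigma_finite.

End step.

Fixpoint borel_lebesgue n : {sigma_finite_measure set (n.-tuple BR) -> \bar R} :=
  match n with
  | 0 => \d_[tuple]
  | k.+1 => lebesgue_cons (borel_lebesgue k)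
  end.

Lemma borel_lebesgue_box n (I : 'I_n -> interval R) :
  borel_lebesgue n [set x | forall i, tnth x i \in I i] =
  \prod_(i < n) lebesgue_measure [set` I i].
Proof.
elim: n => [|n IH] in I *.
  by rewrite big_ord0 /= diracE mem_set// => -[].
rewrite big_ord_recl -IH -lebesgue_consE//; last first.
  rewrite (_ : mkset _ = \big[setI/setT]_(i < n)
      ((fun x : n.-tuple BR => tnth x i) @^-1` [set` I (lift ord0 i)])).
    apply: bigsetI_measurable => i _.
    by rewrite -[X in measurable X]setTI; exact: measurable_tnth.
  apply/seteqP; split => x /=; first by rewrite -bigcap_seq => + i _; exact.
  by rewrite -bigcap_seq => + i; apply; rewrite /= mem_index_enum.
congr (lebesgue_cons _ _); apply/seteqP; split=> x /= xI.
  split=> [|i]; first exact: xI.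
  by have := xI (lift ord0 i); rewrite {1}[x]tuple_eta tnthS.
move=> i; case: (unliftP ord0 i) => [j|] ->; last exact: xI.1.
by rewrite [x]tuple_eta tnthS; exact: xI.2.
Qed.

(* The completion of borel_lebesgue n; its measurable sets are all the Lebesgue
   measurable sets of R^n. *)
Definition lebesgue_Rn n : set _ -> \bar R :=
  @completed_measure_extension _ _ _ (borel_lebesgue n).
HB.instance Definition _ n := Measure.on (@lebesgue_Rn n).

End borel_lebesgue.
Arguments lebesgue_Rn : clear implicits.

(* Main.v *)
(** If [Phi t <= Psi (C * t)], comparing integrals gives the inclusion and the
    norm inequality, the latter with the same [C].

    If the norm inequality holds with [C], test it on [f = t 1_E] with
    [|E| = 1 / v] and [v >= Psi (2 C t)]: then [||f||_Psi <= 1 / (2 C)], hence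
    [||f||_Phi < 1], which forces [Phi t <= v].

    If the pointwise inequality fails for every constant, convexity provides
    [t_k > 0] with [2^(k+1) Psi (k t_k) < Phi t_k].  On disjoint sets [E_k] of
    measure [1 / Phi t_k], put [f = k t_k].  Then the integral of [Psi f] is at
    most [\sum_k 2^-(k+1)], whereas the integral of [Phi (a f)] has infinitely many
    terms [>= 1] for every [a > 0], so [f] is in L_Psi but not in L_Phi. *)

Require Import Defs.
From HB Require Import structures.
From mathcomp Require Import all_boot all_order all_algebra.
From mathcomp Require Import all_classical all_reals all_analysis.
From mathcomp Require Import measurable_realfun.

Import Order.TTheory GRing.Theory Num.Theory.
Import numFieldNormedType.Exports.

Local Open Scope classical_set_scope.
Local Open Scope ring_scope.

(** * Growth and measurability of Young functions *)

Section young.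
Context {R : realType} {Phi : R -> R}.
Hypothesis yPhi : young_function Phi.

(** Convexity on the segment from 0 to [t], where [Phi 0 = 0] removes the second term. *)
Lemma young_scale (l t : R) : 0 <= l <= 1 -> 0 <= t ->
  Phi (l * t) <= l * Phi t.
Proof.
move=> /andP[l0 l1] t0.
have i01 : Itv.spec (@Itv.num_sem R) (Itv.Real `[0%Z, 1%Z]) l.
  by rewrite /Itv.num_sem/= ger0_real//= in_itv/= l0 l1.
have : Phi (l * t + (1 - l) * 0) <= l * Phi t + (1 - l) * Phi 0.
  by apply: (young_convex yPhi (Itv.mk i01)); rewrite inE/= in_itv/= ?t0 ?lexx.
by rewrite (young0 yPhi) !mulr0 !addr0.
Qed.

(** Write [s = (s / t) * t] with [s / t <= 1]: scaling gives [Phi s <= (s / t) * Phi t], and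
    [Phi t >= 0] does the rest. *)
Lemma young_le : {in Num.nneg &, {homo Phi : s t / s <= t}}.
Proof.
move=> s t; rewrite !nnegrE => s0 t0 st.
have [t0'|tn0] := eqVneq t 0.
  by have -> : s = t by apply/eqP; rewrite eq_le st t0' s0.
have tp : 0 < t by rewrite lt_neqAle eq_sym tn0.
rewrite -[s](divfK tn0).
have st1 : 0 <= s / t <= 1 by rewrite divr_ge0//= ler_pdivrMr// mul1r.
apply: (le_trans (young_scale _ _ st1 t0)).
by rewrite ler_piMl ?(young_ge0 yPhi)//; case/andP: st1.
Qed.

Lemma measurable_young d (T : measurableType d) (g : T -> R) :
  measurable_fun [set: T] g -> (forall x, 0 <= g x) ->
  measurable_fun [set: T] ((fun x => (Phi (g x))%:E) : T -> \bar R).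
Proof.
move=> mg g0; apply/measurable_EFinP.
(* [Phi] is unconstrained on negative reals; precomposing with [Num.max 0] makes it nondecreasing on
   all of [R], hence measurable. *)
have -> : (fun x => Phi (g x)) = (Phi \o Num.max 0) \o g.
  by apply/funext => x /=; rewrite (max_idPr (g0 x)).
apply: measurableT_comp => //; apply: nondecreasing_measurable => //.
move=> s t st /=; apply: young_le; rewrite ?nnegrE; first 2 last.
  by rewrite ge_max !le_max lexx st orbT.
all: by rewrite le_max lexx.
Qed.

End young.

(** * Functions constant on each of countably many disjoint sets *)

Lemma measurable_fun_eq_cst d1 d2 (T1 : measurableType d1)
    (T2 : measurableType d2) (D : set T1) (f : T1 -> T2) (y : T2) :
  (forall x, D x -> f x = y) -> measurable_fun D f.
Proof.
move=> fy; have cf : {in D, cst y =1 f} by move=> x /set_mem /fy ->.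
exact: (eq_measurable_fun _ cf (measurable_cst _)).
Qed.

Section step_function.
Context {d} {T : measurableType d} {R : realType}.
Context (mu : {measure set T -> \bar R}) {E : (set T)^nat} (c : R^nat).
Hypotheses (mE : forall k, measurable (E k)) (tE : trivIset setT E).

Lemma step_function_ex : exists f : T -> R,
  [/\ measurable_fun setT f, forall k x, E k x -> f x = c k &
      forall x, ~ (\bigcup_k E k) x -> f x = 0].
Proof.
(* On the union the index is unique by disjointness, so the default index of [xget] is never
   taken. *)
pose f x := if x \in \bigcup_k E k then c (xget 0%N [set k | E k x]) else 0.
have fE k x : E k x -> f x = c k.
  move=> Ex; rewrite /f mem_set; last by exists k.
  congr c; case: xgetP => [j _ /= Ejx|/(_ k)//].
  by apply: (tE j k) => //; exists x.
have f0 x : ~ (\bigcup_k E k) x -> f x = 0 by move=> Ex; rewrite /f memNset.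
exists f; split => //.
(* The complement of the union takes index 0, so that the [F k] cover the space and [f] is constant
   on each of them. *)
pose F k := if k is k'.+1 then E k' else ~` \bigcup_k E k.
have mF k : measurable (F k).
  by case: k => //=; apply: measurableC; exact: bigcup_measurable.
have -> : setT = \bigcup_k F k.
  apply/esym; rewrite -subTset => x _.
  have [[k _ Ex]|Ex] := pselect ((\bigcup_k E k) x); first by exists k.+1.
  by exists 0%N.
apply/measurable_fun_bigcup => // -[|k] /=.
  exact: measurable_fun_eq_cst f0.
exact: measurable_fun_eq_cst (fE k).
Qed.

(** Since [g 0 = 0], only the union contributes; countable additivity over the [E k] then gives the
    series. *)
Lemma integral_step_function (f : T -> R) (g : R -> R) :
  (forall k x, E k x -> f x = c k) ->
  (forall x, ~ (\bigcup_k E k) x -> f x = 0) ->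
  g 0 = 0 -> (forall k, 0 <= g (c k)) ->
  (\int[mu]_x (g (f x))%:E = \sum_(k <oo) (g (c k))%:E * mu (E k))%E.
Proof.
move=> fE f0 g0 gc0.
transitivity (\int[mu]_(x in \bigcup_k E k) (g (f x))%:E)%E.
  rewrite [RHS]integral_mkcond; apply: eq_integral => x _.
  by rewrite patchE; case: ifPn => // /negP Ex; rewrite f0 ?g0// => /mem_set.
rewrite ge0_integral_bigcup//.
- apply: eq_eseriesr => k _; rewrite -integral_cst//.
  by apply: eq_integral => x /set_mem Ex; rewrite (fE k).
- apply/measurable_fun_bigcup => // k.
  by apply: (@measurable_fun_eq_cst _ _ _ _ _ _ (g (c k))%:E) => x /fE ->.
- by move=> x [k _ Ex]; rewrite lee_fin (fE k).
Qed.

End step_function.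

(** The property of Lebesgue measure from which the test functions of both converse implications are
    built. *)
Definition has_disjoint_masses {d} {T : measurableType d} {R : realType}
    (mu : {measure set T -> \bar R}) :=
  forall m : R^nat, (forall k, 0 < m k) ->
  exists E : (set T)^nat,
    [/\ forall k, measurable (E k), trivIset setT E &
        forall k, mu (E k) = (m k)%:E].

(** * Inclusion and norm comparison over an abstract measure *)

Section orlicz_inclusion.
Context {d} {T : measurableType d} {R : realType}.
Context (mu : {measure set T -> \bar R}) {Phi Psi : R -> R}.
Hypotheses (yPhi : young_function Phi) (yPsi : young_function Psi).

Section dominated.
Context {C : R}.
Hypotheses (C0 : 0 < C) (PhiPsi : forall t, 0 < t -> Phi t <= Psi (C * t)).

Lemma young_dominated_integral (f : T -> R) (a : R) :
  measurable_fun setT f -> 0 <= a ->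
  (\int[mu]_x (Phi (a * `|f x|))%:E <=
   \int[mu]_x (Psi (C * a * `|f x|))%:E)%E.
Proof.
move=> mf a0.
have mnf b : measurable_fun setT (fun x => b * `|f x|).
  by apply: measurable_funM => //; exact: measurableT_comp.
have Ca0 : 0 <= C * a by rewrite mulr_ge0// ltW.
apply: ge0_le_integral => //.
- by move=> x _; rewrite lee_fin (young_ge0 yPhi)// mulr_ge0.
- by apply: measurable_young => // x; rewrite mulr_ge0.
- by apply: measurable_young => // x; rewrite mulr_ge0.
move=> x _; rewrite lee_fin -mulrA.
(* Domination is assumed at positive arguments only; at 0 both sides vanish. *)
have [->|n0] := eqVneq (a * `|f x|) 0.
  by rewrite mulr0 (young0 yPhi) (young0 yPsi).
by apply: PhiPsi; rewrite lt_neqAle eq_sym n0 mulr_ge0.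
Qed.

Lemma orlicz_space_dominated : orlicz_space mu Psi `<=` orlicz_space mu Phi.
Proof.
move=> f [mf [a a0 fa]]; split => //; exists (a / C); first by rewrite divr_gt0.
apply: le_lt_trans fa.
have aE : a = C * (a / C) by rewrite mulrC divfK ?gt_eqF.
by rewrite [in leRHS]aE; apply: young_dominated_integral => //;
  rewrite ltW// divr_gt0.
Qed.

(** If [b] is admissible in the infimum for [Psi], then [b * C] is admissible in the one for
    [Phi]. *)
Lemma orlicz_norm_dominated (f : T -> R) : measurable_fun setT f ->
  (orlicz_norm mu Phi f <= C%:E * orlicz_norm mu Psi f)%E.
Proof.
move=> mf; rewrite muleC -lee_pdivrMr//; apply/ereal_infP => _ [b [b0 fb] <-].
rewrite lee_pdivrMr// -EFinM; apply: ereal_inf_lbound.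
exists (b * C) => //; split; first by rewrite mulr_gt0.
apply: le_trans fb.
under eq_integral do rewrite mulrC.
under [leRHS]eq_integral do rewrite mulrC.
have bE : b^-1 = C * (b * C)^-1 by rewrite invfM mulrCA divff ?mulr1// gt_eqF.
rewrite bE; apply: young_dominated_integral => //.
by rewrite invr_ge0 mulr_ge0// ltW.
Qed.

End dominated.

Hypothesis mu_masses : has_disjoint_masses mu.

Lemma orlicz_space_sub_dominated :
  orlicz_space mu Psi `<=` orlicz_space mu Phi ->
  exists2 C : R, 0 < C & forall t, 0 < t -> Phi t <= Psi (C * t).
Proof.
move=> sub; apply: contrapT => nC.
have /choice[t tP] k : exists t : R,
    0 < t /\ 2 ^+ k.+1 * Psi (k%:R * t) < Phi t.
  apply: contrapT => nt; apply: nC.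
  (* Were there no such [t], this constant would work: convexity turns the factor [2 ^+ k.+1] inside
     [Psi] into one outside. Taking [k.+1] instead of [k] keeps it positive at [k = 0]. *)
  exists (2 ^+ k.+1 * k.+1%:R); first by rewrite mulr_gt0// exprn_gt0.
  move=> s s0; rewrite leNgt; apply/negP => Phis.
  apply: nt; exists s; split => //.
  apply: le_lt_trans Phis.
  rewrite -ler_pdivlMl ?exprn_gt0//.
  set r := 2 ^+ k.+1 * _ * s.
  have r0 : 0 <= r by rewrite !mulr_ge0// ltW.
  have p0 : (0 : R) < 2 ^+ k.+1 by rewrite exprn_gt0.
  apply: (@le_trans _ _ (Psi ((2 ^+ k.+1)^-1 * r))).
    have s0' := ltW s0; apply: (young_le yPsi).
    - by rewrite nnegrE mulr_ge0.
    - by rewrite nnegrE mulr_ge0// invr_ge0 ltW.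
    - by rewrite /r -!mulrA mulKf ?gt_eqF// ler_pM2r// ler_nat.
  apply: (young_scale yPsi) => //.
  by rewrite invr_ge0 ltW//= invf_le1// exprn_ege1// ler1n.
have t0 k : 0 < t k by have [] := tP k.
have Psi0 k : 0 <= Psi (k%:R * t k).
  by apply: (young_ge0 yPsi); rewrite mulr_ge0// ltW.
have Phi0 k : 0 < Phi (t k).
  have [_] := tP k; apply: le_lt_trans; by rewrite mulr_ge0// exprn_ge0.
have [|E [mE tE muE]] := mu_masses (fun k => (Phi (t k))^-1).
  by move=> k; rewrite invr_gt0.
have [f [mf fE f0]] := step_function_ex (fun k => k%:R * t k) mE tE.
have nc k : `|k%:R * t k| = k%:R * t k by rewrite ger0_norm// mulr_ge0// ltW.
have fPsi : orlicz_space mu Psi f.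
  split => //; exists 1 => //.
  rewrite (integral_step_function mu _ mE tE f (fun s => Psi (1 * `|s|)) fE f0).
  - apply: (@le_lt_trans _ _
        (\sum_(k <oo) ((1 / (2 ^ k.+1)%:R)%:E : \bar R))%E).
      apply: lee_nneseries => k _; first by rewrite mule_ge0// lee_fin mul1r nc.
      rewrite muE -EFinM lee_fin mul1r nc ler_pdivrMr// mul1r natrX.
      by rewrite ler_pdivlMl ?exprn_gt0// ltW//; have [] := tP k.
    by apply: le_lt_trans (epsilon_trick0 xpredT ler01) _; rewrite ltry.
  - by rewrite mul1r normr0 (young0 yPsi).
  - by move=> k; rewrite mul1r nc.
have [_ [a a0]] := sub _ fPsi.
rewrite (integral_step_function mu _ mE tE f (fun s => Phi (a * `|s|)) fE
  f0); last 2 first.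
- by rewrite normr0 mulr0 (young0 yPhi).
- by move=> k; rewrite (young_ge0 yPhi)// mulr_ge0// ltW.
set S := (\sum_(k <oo) _)%E => Soo.
(* From this index on [a * k >= 1], so [Phi (a * k * t k) >= Phi (t k)], the inverse of the mass of
   [E k]. *)
pose K := Num.bound a^-1.
have KP k : (K <= k)%N -> (1 <= (Phi (a * `|k%:R * t k|))%:E * mu (E k))%E.
  move=> Kk; rewrite muE -EFinM lee_fin nc ler_pdivlMr ?invr_gt0// mul1r.
  have tk0 := ltW (t0 k); have a0' := ltW a0.
  apply: (young_le yPhi); rewrite ?nnegrE ?mulr_ge0// mulrA ler_peMl//.
  rewrite -ler_pdivrMl// mulr1 (le_trans (ltW (archi_boundP _))) ?invr_ge0//.
  by rewrite ler_nat.
have term_ge0 k : (0 <= (Phi (a * `|k%:R * t k|))%:E * mu (E k))%E.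
  by rewrite mule_ge0// lee_fin (young_ge0 yPhi)// mulr_ge0// ltW.
(* Among the first [K + N] terms, the last [N] are at least 1 and the others are nonnegative. *)
have SN (N : nat) : ((N%:R)%:E <= S)%E.
  apply: le_trans (nneseries_lim_ge (K + N)%N (fun k _ _ => term_ge0 k)).
  rewrite (@big_cat_nat _ _ _ K)//= ?leq_addr//.
  apply: (@le_trans _ _ (\sum_(K <= k < K + N) 1%:E)%E).
    by rewrite sumEFin sumr_const_nat addKn.
  apply: lee_paddl; first by apply: sume_ge0 => k _; exact: term_ge0.
  rewrite [leLHS]big_nat_cond [leRHS]big_nat_cond.
  by apply: lee_sum => k /andP[/andP[Kk _] _]; exact: KP.
have Sfin : S \is a fin_num.
  by rewrite ge0_fin_numE//; exact: le_trans (SN 0%N).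
have := SN (Num.bound (fine S)).
rewrite -(fineK Sfin) lee_fin leNgt; apply/negP/negPn.
apply: archi_boundP; rewrite fine_ge0//; exact: le_trans (SN 0%N).
Qed.

Lemma orlicz_norm_le_dominated :
  (exists2 C : R, 0 < C & forall f, orlicz_space mu Psi f ->
     (orlicz_norm mu Phi f <= C%:E * orlicz_norm mu Psi f)%E) ->
  exists2 C : R, 0 < C & forall t, 0 < t -> Phi t <= Psi (C * t).
Proof.
(* The factor 2 brings the [Phi]-norm of the test function down to 1/2, strictly below 1, so that
   some [b < 1] is admissible. *)
move=> [C C0 norm_le]; exists (2 * C); first by rewrite mulr_gt0.
move=> t t0; have C20 : 0 < 2 * C by rewrite mulr_gt0.
have Psit : 0 <= Psi (2 * C * t).
  by apply: (young_ge0 yPsi); rewrite mulr_ge0// ltW.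
(* [Psi (2 * C * t)] may be 0; adding [e] makes [v^-1] a legitimate mass. *)
apply/ler_addgt0Pr => e e0; set v := _ + e.
have v0 : 0 < v by rewrite ltr_wpDl.
have [|E [mE _ muE]] := mu_masses (fun=> v^-1); first by rewrite invr_gt0.
pose f x := t * \1_(E 0%N) x.
have mf : measurable_fun setT f.
  by apply: measurable_funM => //; exact: measurable_indic.
have fint (Th : R -> R) : young_function Th -> forall a, 0 <= a ->
    (\int[mu]_x (Th (a * `|f x|))%:E = (Th (a * t) / v)%:E)%E.
  move=> yTh a a0; rewrite EFinM -(muE 0%N) -integral_cst//.
  rewrite [RHS]integral_mkcond.
  apply: eq_integral => x _; rewrite patchE /f indicE.
  case: ifPn => _; first by rewrite mulr1 gtr0_norm.
  by rewrite mulr0 normr0 mulr0 (young0 yTh).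
have fPsi : (\int[mu]_x (Psi (2 * C * `|f x|))%:E <= 1)%E.
  by rewrite (fint _ yPsi) ?(ltW C20)// lee_fin ler_pdivrMr// mul1r lerDl ltW.
have PsiE : (orlicz_norm mu Psi f <= ((2 * C)^-1)%:E)%E.
  apply: ereal_inf_lbound; exists (2 * C)^-1 => //.
  split; first by rewrite invr_gt0.
  by under eq_integral do rewrite invrK mulrC.
have : (orlicz_norm mu Phi f < 1)%E.
  apply: (@le_lt_trans _ _ (C%:E * ((2 * C)^-1)%:E)%E).
    apply: le_trans (lee_wpmul2l _ PsiE); last by rewrite lee_fin ltW.
    apply: norm_le; split => //; exists (2 * C) => //.
    by apply: le_lt_trans fPsi _; rewrite ltry.
  by rewrite -EFinM lte_fin invfM mulrCA divff ?gt_eqF// mulr1 invf_lt1// ltr1n.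
(* Admissibility of [b] reads [Phi (b^-1 * t) <= v], and [t <= b^-1 * t] because [b < 1]. *)
move=> /ereal_inf_lt[_ [b [b0 fb] <-]]; rewrite lte_fin => b1.
move: fb; under eq_integral do rewrite mulrC.
rewrite (fint _ yPhi) ?invr_ge0 ?(ltW b0)// lee_fin ler_pdivrMr// mul1r.
apply: le_trans; apply: (young_le yPhi).
- by rewrite nnegrE ltW.
- by rewrite nnegrE mulr_ge0 ?invr_ge0// ltW.
- by rewrite ler_peMl ?(ltW t0)// invf_ge1// ltW.
Qed.

End orlicz_inclusion.

(** * Disjoint sets of prescribed Lebesgue measure, and the equivalence *)

Lemma lebesgue_RnE (R : realType) n (A : set (n.-tuple (measurableTypeR R))) :
  measurable A -> lebesgue_Rn R n A = borel_lebesgue R n A.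
Proof. exact: measurable_mu_extE. Qed.

Lemma measurable_box (R : realType) n (I : 'I_n -> interval R) :
  measurable ([set x | forall i, tnth x i \in I i] :
    set (n.-tuple (measurableTypeR R))).
Proof.
rewrite (_ : mkset _ = \big[setI/setT]_(i < n)
    ((fun x : n.-tuple (measurableTypeR R) => tnth x i) @^-1` [set` I i])).
  apply: bigsetI_measurable => i _; rewrite -[X in measurable X]setTI.
  by apply: measurable_tnth => //; exact: measurable_itv.
apply/seteqP; split => x /=; rewrite -bigcap_seq; first by move=> + i _; exact.
by move=> + i; apply; rewrite /= mem_index_enum.
Qed.

Lemma lebesgue_Rn_disjoint_masses (R : realType) n : (1 <= n)%N ->
  has_disjoint_masses (lebesgue_Rn R n).
Proof.
case: n => // n _ m m0.
pose s k : R := \sum_(j < k) m j.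
have sS k : s k.+1 = s k + m k by rewrite /s big_ord_recr.
have s_le : {homo s : j k / (j <= k)%N >-> j <= k}.
  by apply: homo_leq => // [|k]; [exact: le_trans | rewrite sS lerDl ltW].
(* Consecutive half-open intervals of length [m k] on the first axis, times a unit cube in the other
   coordinates. *)
pose I k (i : 'I_n.+1) : interval R :=
  if i == ord0 then `[s k, s k.+1[ else `[0, 1[.
pose E k : set (n.+1.-tuple (measurableTypeR R)) :=
  [set x | forall i, tnth x i \in I k i].
have mE k : measurable (E k) by exact: measurable_box.
exists E; split.
- by move=> k; apply: sub_caratheodory; exact: sub_sigma_algebra.
- move=> j k _ _ [x [/(_ ord0) Ej /(_ ord0) Ek]].
  move: Ej Ek; rewrite /I eqxx !in_itv/= => /andP[sj js] /andP[sk ks].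
  case: (ltngtP j k) => // /s_le s_lt.
    by have := lt_le_trans js (le_trans s_lt sk); rewrite ltxx.
  by have := lt_le_trans ks (le_trans s_lt sj); rewrite ltxx.
- move=> k; transitivity (borel_lebesgue R n.+1 (E k)).
    exact: lebesgue_RnE.
  rewrite borel_lebesgue_box big_ord_recl/=.
  rewrite big1 ?mule1 => [|i _]; rewrite lebesgue_measure_itv/=.
    by rewrite lte_fin sS ltrDl m0 -EFinB addrC addKr.
  by rewrite lte_fin ltr01 -EFinB subr0.
Qed.

Theorem theorem2p5 (R : realType) (n : nat) (n_ge1 : (1 <= n)%N)
    (Phi Psi : R -> R) (yPhi : young_function Phi) (yPsi : young_function Psi) :
  [<-> exists2 C : R, 0 < C & forall t, 0 < t -> Phi t <= Psi (C * t);
       orlicz_space (lebesgue_Rn R n) Psi `<=` orlicz_space (lebesgue_Rn R n) Phi;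
       exists2 C : R, 0 < C & forall f, orlicz_space (lebesgue_Rn R n) Psi f ->
         (orlicz_norm (lebesgue_Rn R n) Phi f
            <= C%:E * orlicz_norm (lebesgue_Rn R n) Psi f)%E].
Proof.
have masses := lebesgue_Rn_disjoint_masses R n n_ge1.
tfae.
- by move=> [C C0 PhiPsi];
  exact: (orlicz_space_dominated _ yPhi yPsi C0 PhiPsi).
(* The inclusion yields the norm bound by way of the pointwise inequality. *)
- move=> /(orlicz_space_sub_dominated _ yPhi yPsi masses)[C C0 PhiPsi].
  exists C => // f [mf _].
  exact: (orlicz_norm_dominated _ yPhi yPsi C0 PhiPsi).
- exact: orlicz_norm_le_dominated.
Qed.
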